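(* Let $G=(V,E)$ be a finite simple connected $4$-valent graph (every vertex has degree $4$) which is also $4$-edge-connected. Then the rank $r(G)$ of its generic planar rigidity matroid satisfies $$r(G)\geq \frac{7|V|-7}{4}.$$
   Context: All graphs are finite and simple. A graph is called $k$-edge-connected ($k\in\mathbb{N}$) if it remains connected upon removing any $k-1$ edges. For a graph $G=(V,E)$ and a map $\mathbf{p}:V\to\mathbb{R}^2$ (a planar realization, or configuration), the rigidity matrix $R(\mathbf{p})$ is the $|E|\times 2|V|$ real matrix whose row indexed by an edge $e_{ij}$ joining $v_i$ and $v_j$ has $\mathbf{p}(v_i)-\mathbf{p}(v_j)$ in the two columns belonging to $v_i$, $\mathbf{p}(v_j)-\mathbf{p}(v_i)$ in the two columns belonging to $v_j$, and $0$ elsewhere. Its rank is denoted $r(G(\mathbf{p}))$. When $\mathbf{p}$ is generic (for instance, the $2|V|$ coordinates of the points $\mathbf{p}(v)$ are algebraically independent over $\mathbb{Q}$), the rank does not depend on $\mathbf{p}$; this common value is denoted $r(G)$ and is the rank of the generic rigidity matroid of $G$. *)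

(* Defs.v *)
From HB Require Import structures.
From mathcomp Require Import all_boot all_order all_algebra.
From mathcomp Require Import reals mpoly.

Set Implicit Arguments.
Unset Strict Implicit.
Unset Printing Implicit Defensive.

Import Order.TTheory GRing.Theory Num.Theory.
Local Open Scope ring_scope.

Record simple_graph (V : finType) := SimpleGraph {
  adj :> rel V;
  adj_sym : ssrbool.symmetric adj;
  adj_irr : irreflexive adj
}.

(* An edge is the two-element set of its endpoints. *)
Definition edges (V : finType) (G : simple_graph V) : {set {set V}} :=
  [set [set xy.1; xy.2] | xy : V * V & G xy.1 xy.2].

Definition regular (d : nat) (V : finType) (G : simple_graph V) : Prop :=
  forall x : V, #|[set y | G x y]| = d.

Definition graph_connected (V : finType) (e : rel V) : Prop :=
  forall x y : V, connect e x y.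

Definition del_edges (V : finType) (G : simple_graph V) (F : {set {set V}}) :
    rel V :=
  [rel x y | G x y && ([set x; y] \notin F)].

Definition edge_connected (k : nat) (V : finType) (G : simple_graph V) : Prop :=
  forall F : {set {set V}},
    F \subset edges G -> (#|F| < k)%N -> graph_connected (del_edges G F).

(* Rows are indexed by the edges and columns by the pairs (vertex, coordinate),
   both through [enum_val]. Since an edge [f] containing [v] is a pair, the sum
   below has exactly one term, that of the other endpoint of [f]. *)
Definition rigidity_matrix (R : realType) (V : finType) (G : simple_graph V)
    (p : V -> 'rV[R]_2) : 'M[R]_(#|edges G|, #|{: V * 'I_2}|) :=
  \matrix_(i, j)
    let f : {set V} := @enum_val _ (mem (edges G)) i in
    let: (v, c) := @enum_val _ (mem {: V * 'I_2}) j in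
    if v \in f then \sum_(u in f :\ v) (p v 0 c - p u 0 c) else 0.

Definition rigidity_rank (R : realType) (V : finType) (G : simple_graph V)
    (p : V -> 'rV[R]_2) : nat :=
  \rank (rigidity_matrix G p).

Definition algebraically_independent (R : realType) (I : finType) (x : I -> R) :
    Prop :=
  forall P : {mpoly rat[#|I|]},
    (map_mpoly (@ratr R) P).@[fun i => x (enum_val i)] = 0 -> P = 0.

(* The generic rank r(G) is the common value of [rigidity_rank G p] over all
   configurations [p] that are generic in this sense. *)
Definition generic (R : realType) (V : finType) (p : V -> 'rV[R]_2) : Prop :=
  algebraically_independent (fun vc : V * 'I_2 => p vc.1 0 vc.2).

(* Main.v *)
Require Import Defs.
From HB Require Import structures.
From mathcomp Require Import all_boot all_order all_algebra.
From mathcomp Require Import reals mpoly ring zify.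

(** The generic rank is at least the size of any edge set that is independent
    in the generic rigidity matroid, so the point is to find a large one.

    Call an edge set sparse if every set [X] of at least two vertices induces at
    most [2|X| - 3] of its edges, and call [X] tight in case of equality.  By
    Laman's theorem ([sparse_independent]) a sparse edge set has independent
    rows in the rigidity matrix of a generic realization.  It is proved by
    induction on the number of edges.  A nonempty sparse set has a vertex of
    degree one, two or three ([low_degree]).  In degree at most two, balance of
    forces at the vertex kills its edges.  In degree three the vertex can be
    deleted and two of its neighbours [a], [b] joined without losing sparsity
    ([reducible_pair]); conversely, placing the vertex at the midpoint of [ab]
    turns any self-stress into one of the smaller edge set
    ([independent_edge_split]), and independence at one special position gives
    independence at every generic one ([generic_independent]), because it is the
    nonvanishing of some polynomial with rational coefficients.

    Now let [F] be a maximal sparse subset of the edge set [E] of [G].  Two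
    tight sets meeting in two vertices have a tight union, so distinct maximal tight
    sets, the blocks, share at most one vertex; by maximality of [F] they cover
    [E].  Hence [|E|] and [|F|] are the sums over the blocks [X] of the numbers
    of edges that [X] induces in [E] and in [F], the latter being [2|X| - 3].  If
    the whole vertex set is a block then [|F| = 2|V| - 3].  Otherwise, at least
    four edges leave each block, so it induces at most [2|X| - 2] edges of [E].
    Then [8(2|X| - 3)] is at least [7] times the number of edges of [E] induced
    by [X], except for a deficit of [2] when [X] spans a [K4], and with a surplus
    of [1] when [X] is a single edge ([block_bound]).  Each vertex of a [K4]
    block has a single edge leaving it, and that edge is a block on its own
    ([quad_other_block]); as an edge has only two ends, there are at least twice
    as many single edges as [K4] blocks ([few_quads]), and the surplus pays for
    the deficit.  So [8|F| >= 7|E| = 14|V|] in that case ([sparse_size]). *)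

Set Implicit Arguments.
Unset Strict Implicit.
Unset Printing Implicit Defensive.

(** * Sparse edge sets and tight vertex sets *)

Section Sparsity.
Variable V : finType.
Implicit Types (E F : {set {set V}}) (X Y Z : {set V}) (e : {set V}).

Definition pairs F := [forall e in F, #|e| == 2].
Definition induced F X := [set e in F | e \subset X].
Definition sparse F :=
  [forall X : {set V}, (1 < #|X|) ==> (#|induced F X| + 3 <= 2 * #|X|)].
Definition tight F X := (1 < #|X|) && (#|induced F X| + 3 == 2 * #|X|).
Definition without F (v : V) := [set e in F | v \notin e].
Definition star F (v : V) := [set e in F | v \in e].

Lemma pairsP F : reflect (forall e, e \in F -> #|e| = 2) (pairs F).
Proof.
apply: (iffP forall_inP) => H e eF; [exact/eqP/H | exact/eqP/H].
Qed.

Lemma sparseP F :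
  reflect (forall X, 1 < #|X| -> #|induced F X| + 3 <= 2 * #|X|) (sparse F).
Proof.
by apply: (iffP forallP) => H X; [move/implyP: (H X) | apply/implyP/H].
Qed.

Lemma sparsePn F : ~~ sparse F ->
  exists X, 1 < #|X| /\ 2 * #|X| < #|induced F X| + 3.
Proof.
by case/forallPn=> X; rewrite negb_imply -ltnNge => /andP[]; exists X.
Qed.

Lemma tightP F X : reflect (1 < #|X| /\ #|induced F X| + 3 = 2 * #|X|) 
  (tight F X).
Proof. by apply: (iffP andP) => -[? /eqP]. Qed.

Lemma pairsS E F : F \subset E -> pairs E -> pairs F.
Proof. by move=> /subsetP FE /pairsP H; apply/pairsP => e /FE /H. Qed.

Lemma induced_mono E F X Y :
  E \subset F -> X \subset Y -> induced E X \subset induced F Y.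
Proof.
move=> /subsetP EF XY; apply/subsetP => e; rewrite !inE.
by case/andP=> /EF -> /subset_trans ->.
Qed.

Lemma sparseS E F : F \subset E -> sparse E -> sparse F.
Proof.
move=> FE /sparseP H; apply/sparseP => X /H.
have := subset_leq_card (induced_mono FE (subxx X)); lia.
Qed.

Lemma inducedI F X Y : induced F X :&: induced F Y = induced F (X :&: Y).
Proof. by apply/setP => e; rewrite !inE subsetI; case: (e \in F). Qed.

Lemma induced_small F X : pairs F -> #|X| <= 1 -> induced F X = set0.
Proof.
move=> /pairsP F2 X1; apply/setP => e; rewrite !inE; apply/negP.
case/andP => /F2 e2 /subset_leq_card; lia.
Qed.

(** Only an edge joining [X :\: Y] to [Y :\: X] is lost on the left. *)
Lemma induced_supermodular F X Y :
  #|induced F X| + #|induced F Y| <=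
  #|induced F (X :|: Y)| + #|induced F (X :&: Y)|.
Proof.
rewrite -inducedI -cardsUI leq_add2r subset_leq_card //.
by rewrite subUset !induced_mono ?subsetUl ?subsetUr.
Qed.

(** The lower bound [2|X :|: Y| - 3] comes from supermodularity, since sparsity
    bounds the edges induced by [X :&: Y] once it has two elements. *)
Lemma tightU F X Y : sparse F -> tight F X -> tight F Y ->
  1 < #|X :&: Y| -> tight F (X :|: Y).
Proof.
move=> /sparseP Fs /tightP[X2 iX] /tightP[Y2 iY] XY2.
have XUY : 1 < #|X :|: Y|.
  by apply: leq_trans X2 _; rewrite subset_leq_card ?subsetUl.
have := induced_supermodular F X Y; have := cardsUI X Y.
have := Fs _ XY2; have := Fs _ XUY=> ? ? ? ?.
by apply/tightP; split=> //; lia.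
Qed.

Lemma pairE e a b : #|e| = 2 -> a \in e -> b \in e -> a != b -> e = [set a; b].
Proof.
move=> e2 ae be ab; apply/esym/eqP; rewrite eqEcard cards2 ab e2 andbT.
by rewrite subUset !sub1set ae be.
Qed.

Lemma induced_pair F a b : pairs F -> [set a; b] \in F ->
  induced F [set a; b] = [set [set a; b]].
Proof.
move=> /pairsP F2 abF; apply/setP => e; rewrite !inE.
apply/andP/eqP => [[eF eab]|-> //].
by apply/eqP; rewrite eqEcard eab (F2 _ eF) (F2 _ abF).
Qed.

(** A violation of sparsity after adding [ab] can only come from a set that
    contains both ends and had no room left for one more edge.  If [ab] is already
    in [F], then [[set a; b]] is such a set. *)
Lemma addable_or_tight F a b : pairs F -> sparse F -> a != b ->
  [set a; b] \notin F /\ sparse ([set a; b] |: F) \/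
  exists X, [/\ tight F X, a \in X & b \in X].
Proof.
move=> Fp Fs ab; have [abF | abF] := boolP ([set a; b] \in F).
  right; exists [set a; b]; split; rewrite ?set21 ?set22 //.
  by rewrite /tight cards2 ab induced_pair // cards1.
have [Fs' | ] := boolP (sparse ([set a; b] |: F)); first by left.
case/sparsePn => X [X2 big]; right.
have iE : induced ([set a; b] |: F) X \subset [set a; b] |: induced F X.
  apply/subsetP => e; rewrite !inE => /andP[/orP[->//|->] ->].
  by rewrite orbT.
have := subset_leq_card iE; rewrite cardsU1 !inE (negPf abF).
have /sparseP/(_ X X2) iX := Fs; move=> le1.
have [abX | abX] := boolP ([set a; b] \subset X).
  exists X; move: abX; rewrite subUset !sub1set => /andP[aX bX]; split=> //.
  by apply/tightP; split=> //; lia.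
have /subset_leq_card : induced ([set a; b] |: F) X \subset induced F X.
  apply/subsetP => e; rewrite !inE => /andP[/orP[/eqP->|->] //].
  by rewrite (negPf abX).
by move: big iX; lia.
Qed.

Lemma induced_without F v X :
  v \notin X -> induced (without F v) X = induced F X.
Proof.
move=> vX; apply/setP => e; rewrite !inE -andbA; congr andb.
apply/andb_idl => /subsetP eX; apply: contra vX; exact: eX.
Qed.

Lemma without_sub F v : without F v \subset F.
Proof. by apply/subsetP => e; rewrite inE => /andP[]. Qed.

(** If [X] contained [v], then [X :\ v] would induce as many edges as [X]. *)
Lemma tight_without_notin F v X a b : sparse F -> tight (without F v) X ->
  a \in X -> b \in X -> a != b -> v != a -> v != b -> v \notin X.
Proof.
move=> Fs /tightP[X2 iX] aX bX ab va vb; apply/negP => vX.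
have iXE : induced (without F v) X = induced F (X :\ v).
  apply/setP => e; rewrite !inE subsetD1 -andbA; congr andb; exact: andbC.
have XD : 1 < #|X :\ v|.
  have <- : #|[set a; b]| = 2 by rewrite cards2 ab.
  rewrite subset_leq_card // subUset !sub1set !inE aX bX.
  by rewrite eq_sym va eq_sym vb.
have /sparseP/(_ _ XD) := Fs; rewrite -iXE.
have := cardsD1 v X; rewrite vX; lia.
Qed.

(** If two of the sets share two vertices, their union is the desired set.
    Otherwise they pairwise meet in a single vertex, so that they induce disjoint
    edge sets and the union has [|X| + |Y| + |Z| - 3] elements: it induces at
    least [2(|X| + |Y| + |Z|) - 9], that is [2|X :|: Y :|: Z| - 3], edges. *)
Lemma tight_three F X Y Z a b c : pairs F -> sparse F ->
  a != b -> b != c -> a != c ->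
  tight F X -> tight F Y -> tight F Z ->
  a \in X -> b \in X -> b \in Y -> c \in Y -> a \in Z -> c \in Z ->
  exists2 U, tight F U & [set a; b; c] \subset U.
Proof.
move=> Fp Fs ab bc ac tX tY tZ aX bX bY cY aZ cZ.
have [XY|XY] := ltnP 1 #|X :&: Y|.
  exists (X :|: Y); first exact: tightU.
  by rewrite !subUset !sub1set !inE aX bX cY orbT.
have [XZ|XZ] := ltnP 1 #|X :&: Z|.
  exists (X :|: Z); first exact: tightU.
  by rewrite !subUset !sub1set !inE aX bX cZ orbT.
have [YZ|YZ] := ltnP 1 #|Y :&: Z|.
  exists (Y :|: Z); first exact: tightU.
  by rewrite !subUset !sub1set !inE aZ bY cY !orbT.
exists (X :|: Y :|: Z); last first.
  by rewrite !subUset !sub1set !inE aX bX cY !orbT.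
have disj S T : #|S :&: T| <= 1 -> induced F S :&: induced F T = set0.
  by move=> ?; rewrite inducedI induced_small.
have sub : induced F X :|: induced F Y :|: induced F Z
             \subset induced F (X :|: Y :|: Z).
  rewrite !subUset !induced_mono ?subsetUr // -setUA ?subsetUl //.
  by rewrite setUCA subsetUl.
have h1 := subset_leq_card sub.
have h2 := cardsUI (induced F X :|: induced F Y) (induced F Z).
rewrite setIUl !disj // setU0 cards0 in h2.
have h3 := cardsUI (induced F X) (induced F Y); rewrite disj // cards0 in h3.
have h4 := cardsUI (X :|: Y) Z; have h5 := cardsUI X Y; rewrite setIUl in h4.
have h6 := cardsUI (X :&: Z) (Y :&: Z).
have bXY : 0 < #|X :&: Y| by apply/card_gt0P; exists b; rewrite inE bX.
have aXZ : 0 < #|X :&: Z| by apply/card_gt0P; exists a; rewrite inE aX.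
have cYZ : 0 < #|Y :&: Z| by apply/card_gt0P; exists c; rewrite inE cY.
have E0 : X :&: Z :&: (Y :&: Z) = set0.
  apply/setP => x; rewrite !inE; apply/negP => /and3P[/andP[xX xZ] xY _].
  have/cards1P[y Ey] : #|X :&: Y| == 1 by rewrite eqn_leq XY.
  have/cards1P[z Ez] : #|X :&: Z| == 1 by rewrite eqn_leq XZ.
  have := in_setI x X Y; rewrite Ey xX xY inE => /eqP xy.
  have := in_setI b X Y; rewrite Ey bX bY inE => /eqP by'.
  have := in_setI x X Z; rewrite Ez xX xZ inE => /eqP xz.
  have := in_setI a X Z; rewrite Ez aX aZ inE => /eqP az.
  by move: ab; rewrite by' az -xy -xz eqxx.
rewrite E0 cards0 in h6.
case/tightP: tX => X2 iX; case/tightP: tY => Y2 iY.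
case/tightP: tZ => Z2 iZ.
have U2 : 1 < #|X :|: Y :|: Z|.
  apply: leq_trans X2 _; rewrite subset_leq_card // -setUA subsetUl //.
have /sparseP/(_ _ U2) h7 := Fs.
apply/tightP; split=> //.
clear -h1 h2 h3 h4 h5 h6 h7 XY XZ YZ bXY aXZ cYZ iX iY iZ; lia.
Qed.

Definition nbrs F v := [set u | [set v; u] \in F].

Lemma pairs_neq F v u : pairs F -> [set v; u] \in F -> v != u.
Proof. by move=> /pairsP Fp /Fp; rewrite cards2; case: (v != u). Qed.

Lemma star_nbrs F v : pairs F -> star F v = [set [set v; u] | u in nbrs F v].
Proof.
move=> Fp; apply/setP => e; apply/idP/imsetP => [|[u]]; last first.
  by rewrite inE => vuF ->; rewrite inE vuF set21.
rewrite inE => /andP[eF ve]; have e2 := elimT (pairsP F) Fp e eF.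
have /card_gt0P[u] : 0 < #|e :\ v| by move: e2; rewrite (cardsD1 v) ve; lia.
rewrite !inE => /andP[uv ue]; have eE := pairE e2 ve ue; rewrite eq_sym in uv.
by exists u; rewrite ?inE -?eE.
Qed.

Lemma card_star F v : pairs F -> #|star F v| = #|nbrs F v|.
Proof.
move=> Fp; rewrite star_nbrs // card_in_imset // => a b; rewrite !inE.
move=> vaF _ /setP/(_ a); rewrite !inE eqxx orbT.
by rewrite eq_sym (negPf (pairs_neq Fp vaF)) => /esym/eqP.
Qed.

(** The combinatorial half of the inverse of Henneberg's second move.  If no pair
    of neighbours could be joined, some tight set [U] of [F - v] would contain all
    three of them, and [v |: U] would induce [2|U|] edges of [F], one more than
    sparsity permits. *)
Lemma reducible_pair F v : pairs F -> sparse F -> #|nbrs F v| = 3 ->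
  exists a b c, [/\ uniq [:: a; b; c], nbrs F v = [set a; b; c],
    [set a; b] \notin without F v & sparse ([set a; b] |: without F v)].
Proof.
move=> Fp Fs d3; set F0 := without F v.
have F0F : F0 \subset F by exact: without_sub.
have F0p := pairsS F0F Fp; have F0s := sparseS F0F Fs.
have [c cN] : exists c, c \in nbrs F v by apply/card_gt0P; rewrite d3.
have /cards2P[a [b [ab Nab]]] : #|nbrs F v :\ c| == 2.
  by move: d3; rewrite (cardsD1 c) cN add1n => -[->].
have N : nbrs F v = [set a; b; c] by rewrite setUC -Nab setD1K.
have : (c \notin [set a; b]) by rewrite -Nab !inE eqxx.
rewrite !inE negb_or eq_sym (eq_sym c b) => /andP[ac bc].
have [[? ?]|[X [tX aX bX]]] := addable_or_tight F0p F0s ab.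
  by exists a, b, c; split; rewrite //= !inE negb_or ab ac bc.
have [[? ?]|[Y [tY bY cY]]] := addable_or_tight F0p F0s bc.
  exists b, c, a; split; rewrite //= ?N.
    by rewrite !inE negb_or bc (eq_sym b) ab (eq_sym c) ac.
  by rewrite -setUA setUC.
have [[? ?]|[Z [tZ aZ cZ]]] := addable_or_tight F0p F0s ac.
  exists a, c, b; split; rewrite //= ?N.
    by rewrite !inE negb_or ac ab (eq_sym c) bc.
  by rewrite setUAC.
have [U tU] := tight_three F0p F0s ab bc ac tX tY tZ aX bX bY cY aZ cZ.
rewrite !subUset !sub1set => /andP[/andP[aU bU] cU]; exfalso.
have vN u : u \in nbrs F v -> v != u by rewrite inE => /(pairs_neq Fp).
have vU : v \notin U.
  apply: (tight_without_notin Fs tU aU bU) => //;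
    by rewrite vN // N !inE eqxx ?orbT.
have sub : star F v :|: induced F U \subset induced F (v |: U).
  apply/subsetP => e; rewrite in_setU star_nbrs //.
  case/orP => [/imsetP[u uN ->]|]; last first.
    by apply/subsetP/induced_mono; rewrite ?subsetUr.
  move: (uN); rewrite !inE subUset !sub1set !inE eqxx => -> /=.
  by move: uN; rewrite N !inE => /orP[/orP[]|] /eqP ->; rewrite ?aU ?bU ?cU orbT.
have dis : star F v :&: induced F U = set0.
  apply/setP => e; rewrite !inE.
  apply/negP => /andP[/andP[_ ve] /andP[_ /subsetP/(_ v ve)]].
  exact/negP.
have h1 := cardsUI (star F v) (induced F U); rewrite dis cards0 addn0 in h1.
have h2 := subset_leq_card sub; rewrite card_star // d3 in h1.
case/tightP: tU => U2; rewrite induced_without // => iU.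
have vUE : #|v |: U| = #|U|.+1 by rewrite cardsU1 vU.
have vU2 : 1 < #|v |: U| by rewrite vUE ltnW.
have /sparseP/(_ _ vU2) h3 := Fs.
clear -h1 h2 h3 iU vUE; lia.
Qed.

(** Double counting of the incidences between [X] and [F]. *)
Lemma sum_star F X : \sum_(v in X) #|star F v| = \sum_(e in F) #|e :&: X|.
Proof.
transitivity (\sum_(v in X) \sum_(e in F) (v \in e)).
  apply: eq_bigr => v _; rewrite -sum1_card.
  rewrite (eq_bigl (fun e => (e \in F) && (v \in e))) => [|e].
    by rewrite big_mkcondr; apply: eq_bigr => e _; case: ifP.
  by rewrite inE.
rewrite exchange_big; apply: eq_bigr => e _.
rewrite -sum1_card [RHS](eq_bigl (fun v => (v \in X) && (v \in e))).
  by rewrite [RHS]big_mkcondr; apply: eq_bigr => v _; case: ifP.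
by move=> v; rewrite inE andbC.
Qed.

(** The degrees sum up to twice the number of edges, which is at most
    [2(2|X| - 3) < 4|X|] for the set [X] of non-isolated vertices. *)
Lemma low_degree F : pairs F -> sparse F -> F != set0 ->
  exists v, 0 < #|star F v| <= 3.
Proof.
move=> Fp Fs F0; set X := [set v | 0 < #|star F v|].
have FX e : e \in F -> e \subset X.
  move=> eF; apply/subsetP => v ve; rewrite inE; apply/card_gt0P; exists e.
  by rewrite inE eF.
have iX : induced F X = F.
  by apply/setP => e; rewrite inE; apply: andb_idr; apply: FX.
have /set0Pn[e0 e0F] := F0.
have X2 : 1 < #|X|.
  by move/pairsP/(_ e0 e0F): Fp => <-; rewrite subset_leq_card ?FX.
have /sparseP/(_ X X2) := Fs; rewrite iX => le.
have [/existsP[v /andP[vX v3]]|/existsPn noX] :=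
  boolP [exists v, (v \in X) && (#|star F v| <= 3)].
  by exists v; rewrite v3 andbT; rewrite inE in vX.
have := sum_star F X.
have -> : \sum_(e in F) #|e :&: X| = \sum_(e in F) 2.
  apply: eq_bigr => e eF.
  by move/setIidPl: (FX e eF) => ->; move/pairsP: Fp; apply.
have : \sum_(v in X) 4 <= \sum_(v in X) #|star F v|.
  by apply: leq_sum => v vX; have := noX v; rewrite vX -ltnNge.
rewrite !sum_nat_const => h1 h2.
clear -h1 h2 le; lia.
Qed.

End Sparsity.

(** * The blocks of a maximal sparse edge set *)

Section Blocks.
Variable V : finType.
Implicit Types (E F : {set {set V}}) (X Y : {set V}) (e : {set V}).

Definition blocks F := [set X | maxset (tight F) X].

Lemma block_tight F X : X \in blocks F -> tight F X.
Proof. by rewrite inE => /maxsetp. Qed.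

Lemma blocks_meet F X Y : sparse F -> X \in blocks F -> Y \in blocks F ->
  1 < #|X :&: Y| -> X = Y.
Proof.
rewrite !inE => Fs mX mY XY.
have tU := tightU Fs (maxsetp mX) (maxsetp mY) XY.
by rewrite -(maxsetsup mX tU (subsetUl _ _)) (maxsetsup mY tU (subsetUr _ _)).
Qed.

(** Deleting from a tight set a vertex of degree at most one would leave a set
    that induces too many edges. *)
Lemma block_min_degree F X v : pairs F -> sparse F -> X \in blocks F ->
  v \in X -> 2 < #|X| -> 1 < #|nbrs F v :&: X|.
Proof.
move=> Fp Fs /block_tight/tightP[_ iX] vX X3.
have cX : #|X| = #|X :\ v|.+1 by rewrite (cardsD1 v X) vX.
have D2 : 1 < #|X :\ v| by rewrite -ltnS -cX.
have /sparseP/(_ _ D2) iD := Fs.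
have sub : induced F X \subset
    induced F (X :\ v) :|: [set [set v; u] | u in nbrs F v :&: X].
  apply/subsetP => e; rewrite inE => /andP[eF eX].
  have [ve|ve] := boolP (v \in e); rewrite in_setU; last first.
    by rewrite inE eF subsetD1 eX ve.
  apply/orP; right; have : e \in star F v by rewrite inE eF.
  rewrite star_nbrs // => /imsetP[u uN eE]; apply/imsetP; exists u => //.
  by rewrite inE uN; apply: (subsetP eX); rewrite eE set22.
have h : #|induced F X| <= #|induced F (X :\ v)| + #|nbrs F v :&: X|.
  apply: leq_trans (subset_leq_card sub) _.
  by rewrite (leq_trans (leq_card_setU _ _)) // leq_add2l leq_imset_card.
clear -iX cX iD h; lia.
Qed.

Lemma maximal_sparse E : exists F, [/\ F \subset E, sparse F &
  forall e, e \in E -> sparse (e |: F) -> e \in F].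
Proof.
have [|F mF] := @ex_maxset _ (fun F => (F \subset E) && sparse F).
  exists set0; rewrite sub0set; apply/sparseP => X X2.
  rewrite [induced _ _](_ : _ = set0) ?cards0; first by lia.
  by apply/setP => e; rewrite !inE.
have /andP[FE Fs] := maxsetp mF; exists F; split=> // e eE eFs.
have <- : e |: F = F.
  by apply: (maxsetsup mF); rewrite ?subsetUr // subUset sub1set eE FE.
by rewrite setU11.
Qed.

Lemma block_cover E F e : pairs E -> F \subset E -> sparse F ->
  (forall e, e \in E -> sparse (e |: F) -> e \in F) ->
  e \in E -> exists2 X, X \in blocks F & e \subset X.
Proof.
move=> Ep FE Fs maxF eE; have Fp := pairsS FE Ep.
have /eqP/cards2P[a [b [ab eab]]] := elimT (pairsP E) Ep e eE.
have [[eF /maxF]|[X [tX aX bX]]] := addable_or_tight Fp Fs ab.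
  by rewrite -eab => /(_ eE) eF'; rewrite -eab eF' in eF.
have [Y mY XY] := maxset_exists tX; exists Y; first by rewrite inE.
by rewrite eab (subset_trans _ XY) // subUset !sub1set aX bX.
Qed.

Lemma sum_induced_blocks E F : pairs E -> sparse F ->
  (forall e, e \in E -> exists2 X, X \in blocks F & e \subset X) ->
  \sum_(X in blocks F) #|induced E X| = #|E|.
Proof.
move=> /pairsP Ep Fs cov; rewrite -[RHS]sum1_card.
transitivity (\sum_(X in blocks F) \sum_(e in E | e \subset X) 1).
  apply: eq_bigr => X _; rewrite -sum1_card; apply: eq_bigl => e.
  by rewrite inE.
rewrite (exchange_big_dep (mem E)) /=; last by move=> X e _ /andP[].
apply: eq_bigr => e eE; have [X XB eX] := cov e eE.
rewrite (big_pred1 X) // => Y; rewrite eE /=.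
apply/andP/eqP => [[YB eY]|->//]; apply: (blocks_meet Fs) => //.
by rewrite -(Ep e eE) subset_leq_card // subsetI eY eX.
Qed.

Definition boundary E X := [set e in E | #|e :&: X| == 1].

(** Summing degrees over [X] counts induced edges twice and boundary edges
    once. *)
Lemma boundary_count E X d : pairs E -> (forall v, #|nbrs E v| = d) ->
  2 * #|induced E X| + #|boundary E X| <= d * #|X|.
Proof.
move=> Ep reg; have := sum_star E X.
have -> : \sum_(v in X) #|star E v| = d * #|X|.
  rewrite mulnC -sum_nat_const; apply: eq_bigr => v _.
  by rewrite card_star.
move=> ->.
have -> : #|induced E X| = \sum_(e in E) (e \subset X).
  rewrite -sum1_card [RHS](big_mkcond) /= big_mkcond; apply: eq_bigr => e _.
  by rewrite inE; case: (e \in E); case: (e \subset X).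
have -> : #|boundary E X| = \sum_(e in E) (#|e :&: X| == 1).
  rewrite -sum1_card [RHS](big_mkcond) /= big_mkcond; apply: eq_bigr => e _.
  by rewrite inE; case: (e \in E); case: (_ == 1).
rewrite big_distrr -big_split; apply: leq_sum => e /(elimT (pairsP E) Ep) e2.
have [/setIidPl ->|_] := boolP (e \subset X); first by rewrite e2.
by case: eqP => [->|].
Qed.

Lemma induced_leq_bin E X : pairs E -> #|induced E X| <= 'C(#|X|, 2).
Proof.
move=> /pairsP Ep; rewrite -cards_draws subset_leq_card //.
by apply/subsetP => e; rewrite !inE => /andP[/Ep -> ->].
Qed.

Lemma clique_nbrs E X v : pairs E -> #|induced E X| = 'C(#|X|, 2) -> v \in X ->
  X :\ v \subset nbrs E v.
Proof.
move=> /pairsP Ep iX vX; apply/subsetP => u; rewrite !inE => /andP[uv uX].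
have : induced E X == [set A : {set V} | A \subset X & #|A| == 2].
  rewrite eqEcard cards_draws iX leqnn andbT.
  by apply/subsetP => e; rewrite !inE => /andP[/Ep -> ->].
move/eqP/setP/(_ [set v; u]); rewrite !inE cards2 (eq_sym v u) uv.
by rewrite subUset !sub1set vX uX /= andbT => ->.
Qed.

Lemma card_le1_set1 X (x : V) : #|X| <= 1 -> x \in X -> X = [set x].
Proof.
move=> X1 xX; apply/esym/eqP; rewrite eqEcard sub1set xX cards1.
exact: X1.
Qed.

Section Count.
Variables E F : {set {set V}}.
Hypotheses (Ep : pairs E) (FE : F \subset E) (Fs : sparse F).
Hypothesis (maxF : forall e, e \in E -> sparse (e |: F) -> e \in F).
Hypothesis (reg : forall v, #|nbrs E v| = 4).

Let Fp : pairs F := pairsS FE Ep.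

(** Sets that span a [K4] in [E].  Among the blocks other than the whole vertex
    set, only these are too small for the number of edges of [E] they induce. *)
Definition quad X := (#|X| == 4) && (#|induced E X| == 6).

Lemma nbrs_mono v : nbrs F v \subset nbrs E v.
Proof. by apply/subsetP => u; rewrite !inE; apply/subsetP. Qed.

Lemma quad_outside v X : quad X -> v \in X -> #|nbrs E v :\: X| = 1.
Proof.
move=> /andP[/eqP X4 /eqP i6] vX.
have sub : X :\ v \subset nbrs E v by apply: clique_nbrs; rewrite // X4 i6.
have := cardsID X (nbrs E v); rewrite reg.
have -> : nbrs E v :&: X = X :\ v.
  apply/setP => u; rewrite !inE; apply/andP/andP => [[uN uX]|[uv uX]].
    by rewrite eq_sym (pairs_neq Ep uN).
  by split=> //; have := subsetP sub u; rewrite !inE uv uX; apply.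
by have h := cardsD1 v X; rewrite vX X4 in h; move: h; lia.
Qed.

(** In [E], and a fortiori in [F], the vertex [v] has only one neighbour outside
    the [K4], hence at most one in [Y]; a block with three or more vertices would
    need two. *)
Lemma quad_other_block v X Y : quad X -> X \in blocks F -> Y \in blocks F ->
  v \in X -> v \in Y -> X != Y -> #|Y| = 2.
Proof.
move=> qX XB YB vX vY XY.
have /tightP[Y2 _] := block_tight YB.
apply/eqP; rewrite eqn_leq Y2 andbT leqNgt; apply/negP => Y3.
have := block_min_degree Fp Fs YB vY Y3; rewrite ltnNge => /negP; apply.
rewrite -(quad_outside qX vX) subset_leq_card //.
have XY1 : X :&: Y = [set v].
  apply: card_le1_set1; last by rewrite inE vX.
  by rewrite leqNgt; apply: contra XY => /(blocks_meet Fs XB YB) ->.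
apply/subsetP => u; rewrite in_setI => /andP[uN uY]; rewrite in_setD.
rewrite (subsetP (nbrs_mono v)) // andbT; apply/negP => uX.
have : u \in [set v] by rewrite -XY1 inE uX.
rewrite inE => /eqP uv; move: uN; rewrite inE => /(pairs_neq Fp).
by rewrite uv eqxx.
Qed.

(** A [K4] block at [v] is the only [K4] block there, and it is paid for by the
    block of the edge that leaves it at [v]. *)
Lemma quad_charge v :
  \sum_(X in blocks F | v \in X) quad X <=
  \sum_(X in blocks F | v \in X) (#|X| == 2).
Proof.
have [/existsP[X /and3P[XB vX qX]]|no] :=
  boolP [exists X, [&& X \in blocks F, v \in X & quad X]]; last first.
  rewrite big1 // => X /andP[XB vX]; apply/eqP; rewrite eqb0.
  by apply: contra no => qX; apply/existsP; exists X; rewrite XB vX.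
rewrite (bigD1 X) ?XB //= big1 ?addn0 => [|Y /andP[/andP[YB vY] YX]]; last first.
  by rewrite /quad (quad_other_block qX XB YB vX vY) // eq_sym.
have /cards1P[y yE] : #|nbrs E v :\: X| == 1 by rewrite (quad_outside qX vX).
have : y \in nbrs E v :\: X by rewrite yE set11.
rewrite !inE => /andP[yX vyE].
have [Y YB] := block_cover Ep FE Fs maxF vyE.
rewrite subUset !sub1set => /andP[vY yY].
rewrite (bigD1 Y) ?YB //= (quad_other_block qX XB YB vX vY).
  by rewrite qX.
by apply: contraNneq yX => ->.
Qed.

Lemma sum_over_vertices (f : {set V} -> nat) :
  \sum_(X in blocks F) #|X| * f X = \sum_v \sum_(X in blocks F | v \in X) f X.
Proof.
rewrite (exchange_big_dep (mem (blocks F))) /=; last by move=> v X _ /andP[].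
apply: eq_bigr => X XB; rewrite -sum_nat_const; apply: eq_bigl => v.
by rewrite XB.
Qed.

(** Summing [quad_charge] over all vertices counts a [K4] block four times and a
    single edge twice. *)
Lemma few_quads :
  2 * \sum_(X in blocks F) quad X <= \sum_(X in blocks F) (#|X| == 2).
Proof.
have h : \sum_(X in blocks F) #|X| * quad X <=
         \sum_(X in blocks F) #|X| * (#|X| == 2).
  by rewrite !sum_over_vertices; apply: leq_sum => v _; apply: quad_charge.
have h1 : \sum_(X in blocks F) #|X| * quad X = 4 * \sum_(X in blocks F) quad X.
  rewrite big_distrr; apply: eq_bigr => X _.
  by rewrite /quad; case: (#|X| =P 4) => [->|_]; rewrite ?muln0.
have h2 : \sum_(X in blocks F) #|X| * (#|X| == 2) =
          2 * \sum_(X in blocks F) (#|X| == 2).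
  rewrite big_distrr; apply: eq_bigr => X _.
  by case: (#|X| =P 2) => [->|_]; rewrite ?muln0.
move: h; rewrite h1 h2; lia.
Qed.

Lemma edges_card : #|E| = 2 * #|V|.
Proof.
have := sum_star E [set: V].
have -> : \sum_(v in [set: V]) #|star E v| = #|V| * 4.
  rewrite -cardsT -sum_nat_const; apply: eq_bigr => v _.
  by rewrite card_star.
have -> : \sum_(e in E) #|e :&: [set: V]| = #|E| * 2.
  rewrite -sum_nat_const; apply: eq_bigr => e eE.
  by rewrite setIT (elimT (pairsP E) Ep e eE).
lia.
Qed.

Hypothesis cut : forall X, X != set0 -> X != setT -> 4 <= #|boundary E X|.

(** Since [F] has [2|X| - 3] edges in [X], the claim only involves [|X|] and
    the number [i] of edges of [E] in [X].  The cut condition gives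
    [i <= 2|X| - 2], which is enough from [|X| = 5] on; the smaller sizes use
    [i <= 'C(|X|, 2)]. *)
Lemma block_bound X : X \in blocks F -> X != setT ->
  7 * #|induced E X| + (#|X| == 2) <= 8 * #|induced F X| + 2 * quad X.
Proof.
move=> /block_tight/tightP[X2 iF] XT.
have X0 : X != set0 by rewrite -card_gt0 ltnW.
have h1 := boundary_count X Ep reg; have h2 := cut X0 XT.
have h3 := induced_leq_bin X Ep; rewrite bin2 in h3.
rewrite /quad; move: #|induced F X| iF h1 h2 h3 X2 => f.
move: #|induced E X| #|boundary E X| #|X| => i b x iF h1 h2 h3 X2.
have [x2|x2] := eqVneq x 2.
  by move: h3; rewrite x2 /=; lia.
have [x3|x3] := eqVneq x 3.
  by move: h3; rewrite x3 /=; lia.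
have [x4|x4] := eqVneq x 4.
  by move: h3; rewrite x4 /=; case: (i =P 6) => [->|]; lia.
lia.
Qed.

Lemma sparse_size : 7 * #|V| <= 4 * #|F| \/ #|F| + 3 = 2 * #|V|.
Proof.
have [TB|TB] := boolP ([set: V] \in blocks F).
  have /tightP[_] := block_tight TB; rewrite cardsT.
  have -> : induced F [set: V] = F.
    by apply/setP => e; rewrite inE subsetT andbT.
  by right.
left; have cE : \sum_(X in blocks F) #|induced E X| = #|E|.
  by apply: sum_induced_blocks => // e; apply: block_cover.
have cF : \sum_(X in blocks F) #|induced F X| = #|F|.
  apply: sum_induced_blocks => // e /(subsetP FE).
  exact: block_cover.
have : \sum_(X in blocks F) (7 * #|induced E X| + (#|X| == 2)) <=
       \sum_(X in blocks F) (8 * #|induced F X| + 2 * quad X).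
  apply: leq_sum => X XB; apply: block_bound => //.
  by apply: contraNneq TB => <-.
have -> : \sum_(X in blocks F) (7 * #|induced E X| + (#|X| == 2)) =
          7 * #|E| + \sum_(X in blocks F) (#|X| == 2).
  by rewrite big_split -cE big_distrr.
have -> : \sum_(X in blocks F) (8 * #|induced F X| + 2 * quad X) =
          8 * #|F| + 2 * \sum_(X in blocks F) quad X.
  by rewrite big_split -cF !big_distrr.
have := edges_card; have := few_quads; lia.
Qed.

End Count.
End Blocks.

(** * Edge sets of regular, edge-connected graphs *)

Section Graph.
Variables (V : finType) (G : simple_graph V).

Lemma mem_edges x y : ([set x; y] \in edges G) = G x y.
Proof.
apply/imsetP/idP => [[[a b]]|Gxy]; last by exists (x, y); rewrite ?inE.
rewrite inE /= => Gab E.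
have ab : a != b by apply: contraTneq Gab => ->; rewrite adj_irr.
have := set21 a b; rewrite -E !inE => /orP[] /eqP ax.
  have := set22 a b; rewrite -E !inE -ax eq_sym (negPf ab) => /eqP <-.
  by [].
have := set22 a b; rewrite -E !inE -ax (eq_sym b a) (negPf ab) orbF => /eqP <-.
by rewrite adj_sym.
Qed.

Lemma pairs_edges : pairs (edges G).
Proof.
apply/pairsP => e /imsetP[[a b]]; rewrite inE /= => Gab ->.
by rewrite cards2; case: eqP Gab => // ->; rewrite adj_irr.
Qed.

Lemma nbrs_edges v : nbrs (edges G) v = [set y | G v y].
Proof. by apply/setP => u; rewrite !inE mem_edges. Qed.

(** Deleting the boundary of [X] separates [X] from its complement. *)
Lemma edge_connected_boundary k (X : {set V}) : edge_connected k G ->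
  X != set0 -> X != setT -> k <= #|boundary (edges G) X|.
Proof.
move=> kconn /set0Pn[x xX] XT; rewrite leqNgt; apply/negP => lt.
have [y yX] : exists y, y \notin X.
  by apply/existsP; rewrite -negb_forall; apply: contra XT => /forallP H;
     apply/eqP/setP => y; rewrite H inE.
have sub : boundary (edges G) X \subset edges G.
  by apply/subsetP => e; rewrite inE => /andP[].
have cl : closed (del_edges G (boundary (edges G) X)) X.
  move=> u v; rewrite /= => /andP[Guv].
  rewrite !inE mem_edges Guv /= => nb.
  have uv : u != v by apply: contraTneq Guv => ->; rewrite adj_irr.
  case uX: (u \in X); case vX: (v \in X) => //; case/negP: nb.
    rewrite [_ :&: _](_ : _ = [set u]) ?cards1 //.
    apply/setP => z; rewrite !inE; case: (z =P u) => [->|_] //=.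
    by case: eqP => // ->.
  rewrite [_ :&: _](_ : _ = [set v]) ?cards1 //.
  apply/setP => z; rewrite !inE; case: (z =P v) => [->|_]; rewrite ?orbT ?orbF //.
  by case: eqP => // ->.
by have := closed_connect cl (kconn _ sub lt x y); rewrite xX (negPf yX).
Qed.

End Graph.

Import Order.TTheory GRing.Theory Num.Theory.
Local Open Scope ring_scope.

(** * Generic realizations of sparse edge sets *)

Section Generic.
Variables (R : realType) (V : finType).
Implicit Types (p q : V -> 'rV[R]_2) (F : {set {set V}}).

Notation vars := #|{: V * 'I_2}|.

(** The value at [p] of a rational polynomial in the coordinates of the points, as
    a ring morphism, so that it commutes with determinants. *)
Definition eval_at p : {rmorphism {mpoly rat[vars]} -> R} :=
  meval (fun i => let: vc := enum_val i in p vc.1 0 vc.2)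
    \o map_mpoly (@ratr R).

Definition coord (v : V) (c : 'I_2) : {mpoly rat[vars]} :=
  'X_(enum_rank (v, c)).

Lemma eval_coord p v c : eval_at p (coord v c) = p v 0 c.
Proof. by rewrite /= map_mpolyX mevalXU enum_rankK. Qed.

(** To show that a polynomial does not vanish at generic points, it is enough to
    exhibit one point, however special, where it does not. *)
Lemma generic_nonvanishing p q P :
  generic p -> eval_at q P != 0 -> eval_at p P != 0.
Proof.
move=> gp; apply: contra_neq => Pp0.
by have -> : P = 0 by [exact: gp]; rewrite rmorph0.
Qed.

(** The rigidity matrix with rows in an arbitrary set [F]; it is convertible to
    [rigidity_matrix G p] for [F := edges G]. *)
Definition edge_matrix p F : 'M[R]_(#|F|, vars) :=
  \matrix_(i, j)
    let f : {set V} := @enum_val _ (mem F) i in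
    let: (v, c) := @enum_val _ (mem {: V * 'I_2}) j in
    if v \in f then \sum_(u in f :\ v) (p v 0 c - p u 0 c) else 0.

(** The rigidity matrix at indeterminate points. *)
Definition symbolic_matrix F : 'M[{mpoly rat[vars]}]_(#|F|, vars) :=
  \matrix_(i, j)
    let f : {set V} := @enum_val _ (mem F) i in
    let: (v, c) := @enum_val _ (mem {: V * 'I_2}) j in
    if v \in f then \sum_(u in f :\ v) (coord v c - coord u c) else 0.

Lemma eval_symbolic_matrix p F :
  map_mx (eval_at p) (symbolic_matrix F) = edge_matrix p F.
Proof.
apply/matrixP => i j; rewrite !mxE; case: (enum_val j) => v c.
cbv zeta; case: ifP => _; last exact: rmorph0.
by rewrite rmorph_sum; apply: eq_bigr => u _; rewrite rmorphB !eval_coord.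
Qed.

(** In terms of minors, full row rank is visible through ring morphisms. *)
Lemma row_free_minorP (m n : nat) (A : 'M[R]_(m, n)) :
  reflect (exists f : 'I_m -> 'I_n, \det (colsub f A) != 0) (row_free A).
Proof.
apply: (iffP idP) => [fA | [f df]].
  have fAT : row_full A^T by rewrite /row_full mxrank_tr.
  exists (fullrankfun fAT); have := fullrowsub_unit fAT.
  by rewrite unitmxE unitfE -det_tr trmx_mxsub trmxK.
have : row_free (colsub f A) by rewrite row_free_unit unitmxE unitfE.
rewrite /row_free => /eqP rk; rewrite eqn_leq rank_leq_row -{1}rk.
by rewrite -mxrank_tr -(mxrank_tr A) trmx_mxsub mxrankS ?rowsub_sub.
Qed.

Lemma generic_row_free p q F : generic p ->
  row_free (edge_matrix q F) -> row_free (edge_matrix p F).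
Proof.
move=> gp /row_free_minorP[f df]; apply/row_free_minorP; exists f; move: df.
rewrite -!eval_symbolic_matrix -!map_mxsub !det_map_mx.
exact: generic_nonvanishing.
Qed.

(** Equilibrium self-stresses of [p]: the forces exerted along the edges cancel at
    each vertex. The term [u = v] contributes nothing. *)
Definition stress p (w : {set V} -> R) :=
  forall v, \sum_u w [set v; u] *: (p v - p u) = 0.

Definition independent p F := forall w,
  (forall e, e \notin F -> w e = 0) -> stress p w -> forall e, w e = 0.

(** A linear combination of the rows of the rigidity matrix, computed in the
    column [(v, c)], is the [c]-th coordinate of the total force at [v]. *)
Lemma row_combination p F (w : {set V} -> R) v c : pairs F ->
  (forall e, e \notin F -> w e = 0) ->
  \sum_(e in F) w e * (if v \in e then \sum_(u in e :\ v) (p v 0 c - p u 0 c)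
                       else 0)
  = (\sum_u w [set v; u] *: (p v - p u)) 0 c.
Proof.
move=> Fp w0; rewrite summxE.
transitivity (\sum_(e in F) \sum_(u | [&& v \in e, u \in e & u != v])
   w e * (p v 0 c - p u 0 c)).
  apply: eq_bigr => e _; case: ifP => ve.
    by rewrite mulr_sumr; apply: eq_bigl => u; rewrite !inE andbC.
  by rewrite mulr0 big_pred0.
rewrite (exchange_big_dep xpredT) //=; apply: eq_bigr => u _.
rewrite !mxE; have [vuF|vuF] := boolP ([set v; u] \in F).
  have vu : u != v.
    by move/pairsP/(_ _ vuF): Fp; rewrite cards2 eq_sym; case: (u =P v).
  rewrite (big_pred1 [set v; u]) // => e; rewrite vu andbT.
  apply/idP/eqP => [/and3P[eF ve ue]|->]; last by rewrite vuF set21 set22.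
  by apply: pairE; rewrite // 1?eq_sym //; move/pairsP: Fp; apply.
rewrite w0 // mul0r big1 // => e /and4P[eF ve ue uv].
by move: vuF; rewrite -(pairE _ ve ue) ?eF // 1?eq_sym //; move/pairsP: Fp; apply.
Qed.

Lemma independentP p F : pairs F ->
  reflect (independent p F) (row_free (edge_matrix p F)).
Proof.
move=> Fp.
have entry (w : {set V} -> R) j :
    (forall e, e \notin F -> w e = 0) ->
    ((\row_i w (@enum_val _ (mem F) i)) *m edge_matrix p F) 0 j =
    (\sum_u w [set (enum_val j).1; u] *: (p (enum_val j).1 - p u)) 0
       (enum_val j).2.
  move=> w0; rewrite mxE -(row_combination _ _ _ Fp w0) [RHS]big_enum_val.
  by apply: eq_bigr => i _; rewrite !mxE; case: (enum_val j).
apply: (iffP idP) => [free w w0 sw e | ind].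
  have [eF|/w0 //] := boolP (e \in F).
  have u0 : \row_i w (@enum_val _ (mem F) i) *m edge_matrix p F = 0.
    by apply/rowP => j; rewrite entry // sw !mxE.
  move/row_freeP: free => [B FB].
  have := congr1 (mulmx^~ B) u0.
  rewrite mul0mx -mulmxA FB mulmx1 => /rowP/(_ (enum_rank_in eF e)).
  by rewrite !mxE enum_rankK_in.
rewrite -kermx_eq0; apply/rowV0P => u /sub_kermxP uM.
pose w e := if [pick i | @enum_val _ (mem F) i == e] is Some i then u 0 i else 0.
have wE i : w (enum_val i) = u 0 i.
  rewrite /w; case: pickP => [j /eqP/enum_val_inj -> //|/(_ i)].
  by rewrite eqxx.
have w0 e : e \notin F -> w e = 0.
  rewrite /w; case: pickP => // i /eqP <-.
  by rewrite enum_valP.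
have uE : u = \row_i w (@enum_val _ (mem F) i).
  by apply/rowP => i; rewrite mxE wE.
have sw : stress p w.
  move=> v; apply/rowP => c; rewrite mxE.
  have := entry w (enum_rank (v, c)) w0; rewrite -uE uM enum_rankK /= mxE.
  by move <-.
by apply/rowP => i; rewrite mxE -wE ind.
Qed.

(** Independence is an open condition given by rational polynomials, so a special
    position [q] testifies for all generic ones. *)
Lemma generic_independent p q F : pairs F -> generic p ->
  independent q F -> independent p F.
Proof.
move=> Fp gp /(independentP _ Fp) /(generic_row_free gp) H.
exact/(independentP _ Fp).
Qed.

Definition cross (x y : 'rV[R]_2) := x 0 0 * y 0 1 - x 0 1 * y 0 0.

Lemma cross_free (s t : R) (x y : 'rV[R]_2) :
  cross x y != 0 -> s *: x + t *: y = 0 -> s = 0 /\ t = 0.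
Proof.
move=> xy /rowP E; have := E 0; have := E 1; rewrite !mxE => e1 e0.
rewrite /cross in xy.
split; apply/eqP; rewrite -(mulIr_eq0 _ (mulIf xy)); apply/eqP.
  transitivity ((s * x 0 0 + t * y 0 0) * y 0 1 -
                (s * x 0 1 + t * y 0 1) * y 0 0); first by ring.
  by rewrite e0 e1; ring.
transitivity ((s * x 0 1 + t * y 0 1) * x 0 0 -
              (s * x 0 0 + t * y 0 0) * x 0 1); first by ring.
by rewrite e0 e1; ring.
Qed.

Lemma generic_not_collinear p a b c : generic p -> a != b -> b != c -> a != c ->
  cross (p b - p a) (p c - p a) != 0.
Proof.
move=> gp ab bc ac.
pose P := (coord b 0 - coord a 0) * (coord c 1 - coord a 1)
        - (coord b 1 - coord a 1) * (coord c 0 - coord a 0).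
have PE q : eval_at q P = cross (q b - q a) (q c - q a).
  by rewrite rmorphB !rmorphM !rmorphB !eval_coord /cross !mxE.
rewrite -PE.
(* Send [b] and [c] to the two unit vectors and all other points to 0. *)
pose q v : 'rV[R]_2 := \row_i ((v == b) && (i == 0) || (v == c) && (i == 1))%:R.
apply: (@generic_nonvanishing p q) => //.
rewrite PE /cross !mxE !eqxx (negPf ab) (negPf ac) (negPf bc).
rewrite (eq_sym c b) (negPf bc) /=.
by rewrite !subr0 mulr1 mulr0 subr0 oner_eq0.
Qed.

Lemma generic_inj p : generic p -> injective p.
Proof.
move=> gp a b pab; apply/eqP/negPn/negP => ab.
pose q v : 'rV[R]_2 := \row_(i < 2) (v == b)%:R.
have : eval_at p (coord b 0 - coord a 0) != 0.
  apply: (@generic_nonvanishing p q) => //.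
  by rewrite rmorphB !eval_coord !mxE eqxx (negPf ab) subr0 oner_eq0.
by rewrite rmorphB !eval_coord pab subrr eqxx.
Qed.

Lemma stress_at p w v F : (forall e, e \notin F -> w e = 0) -> stress p w ->
  \sum_(u in nbrs F v) w [set v; u] *: (p v - p u) = 0.
Proof.
move=> w0 /(_ v) sw; rewrite -[RHS]sw big_mkcond; apply: eq_bigr => u _.
by rewrite inE; case: ifPn => // /w0 ->; rewrite scale0r.
Qed.

(** Stresses of [F] that vanish at [v] are stresses of [F - v]. *)
Lemma independent_vertex p F v : pairs F ->
  (forall w, (forall e, e \notin F -> w e = 0) -> stress p w ->
     forall u, u \in nbrs F v -> w [set v; u] = 0) ->
  independent p (without F v) -> independent p F.
Proof.
move=> Fp v0 ind w w0 sw; apply: ind => // e; rewrite inE negb_and negbK.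
case: (boolP (e \in F)) => [eF ve|/w0 //].
have : e \in star F v by rewrite inE eF.
by rewrite star_nbrs // => /imsetP[u uN ->]; apply: v0.
Qed.

(** Place [v] at the midpoint [m] of [ab].  As [c] is not on the line [ab],
    equilibrium at [v] forces the stress on [vc] to vanish and those on [va] and
    [vb] to have the same value [t].  The force of the path [a - v - b] at [a] is
    [t (a - m) = (t / 2) (a - b)], so an edge [ab] with stress [t / 2] can
    replace the path. *)
Lemma independent_edge_split p F v a b c : pairs F -> uniq [:: a; b; c] ->
  nbrs F v = [set a; b; c] -> [set a; b] \notin without F v ->
  cross (p b - p a) (p c - p a) != 0 ->
  independent p ([set a; b] |: without F v) ->
  exists q, independent q F.
Proof.
move=> Fp uabc N abF0 abc ind.
move: uabc; rewrite /= !inE negb_or andbT => /andP[/andP[ab ac] bc].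
have vN u : u \in nbrs F v -> v != u by rewrite inE => /(pairs_neq Fp).
have va : v != a by rewrite vN // N !inE eqxx.
have vb : v != b by rewrite vN // N !inE eqxx orbT.
have vc : v != c by rewrite vN // N !inE eqxx orbT.
have vab : v \notin [set a; b] by rewrite !inE negb_or va.
have abF : [set a; b] \notin F by move: abF0; rewrite inE vab andbT.
pose q u := if u == v then 2^-1 *: (p a + p b) else p u.
have qv : q v = 2^-1 *: (p a + p b) by rewrite /q eqxx.
have qE u : v != u -> q u = p u by rewrite /q eq_sym => /negPf ->.
exists q => w w0 sw.
have [wab wc] : w [set v; a] = w [set v; b] /\ w [set v; c] = 0.
  have := stress_at v w0 sw; rewrite N.
  rewrite -setUA big_setU1 ?big_setU1 ?big_set1 ?inE ?negb_or ?ab ?bc //.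
  rewrite qv !qE // => eq0.
  have [] := @cross_free (2^-1 * (w [set v; a] - w [set v; b] + w [set v; c]))
     (- w [set v; c]) _ _ abc.
    by rewrite -[RHS]eq0; apply/rowP => i; rewrite !mxE; field.
  move=> e1 /eqP; rewrite oppr_eq0 => /eqP e2; split=> //.
  move/eqP: e1; rewrite e2 addr0 mulf_eq0 invr_eq0 pnatr_eq0 /= subr_eq0.
  by move/eqP.
(* Half of the common stress of [va] and [vb], to be carried by [ab]. *)
pose s := 2^-1 * w [set v; a].
pose w' e := if e == [set a; b] then s else if v \in e then 0 else w e.
have w'0 e : e \notin [set a; b] |: without F v -> w' e = 0.
  rewrite !inE negb_or negb_and negbK /w' => /andP[/negPf ->].
  by case: ifP => // _; rewrite orbF => /w0.
have sw' : stress p w'.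
  move=> u; have [->|uv] := eqVneq u v.
    apply: big1 => t _; rewrite /w' set21 [_ == _](_ : _ = false) ?scale0r //.
    by apply/eqP => E; move: vab; rewrite -E set21.
  rewrite (bigD1 v) //= {1}/w' set22 [_ == _](_ : _ = false); last first.
    by apply/eqP => E; move: vab; rewrite -E set22.
  rewrite scale0r add0r.
  have pairab t : ([set u; t] == [set a; b]) =
      ((u == a) && (t == b)) || ((u == b) && (t == a)).
    apply/eqP/orP => [E|[|] /andP[/eqP -> /eqP ->] //]; last by rewrite setUC.
    have := set21 u t; rewrite E !inE => /orP[] /eqP ue; [left|right].
      have := set22 a b; rewrite -E !inE ue eq_sym (negPf ab) eqxx.
      by rewrite eq_sym.
    by have := set21 a b; rewrite -E !inE ue (negPf ab) eqxx eq_sym.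
  have := sw u; rewrite (bigD1 v) //= (qE u) 1?eq_sym // qv.
  have -> : \sum_(t | t != v) w [set u; t] *: (p u - q t) =
            \sum_(t | t != v) w [set u; t] *: (p u - p t).
    by apply: eq_bigr => t tv; rewrite qE 1?eq_sym.
  have -> : \sum_(t | t != v) w' [set u; t] *: (p u - p t) =
      \sum_(t | t != v) w [set u; t] *: (p u - p t) +
      \sum_(t | (t != v) && ([set u; t] == [set a; b])) s *: (p u - p t).
    rewrite [X in _ + X]big_mkcondr -big_split /=; apply: eq_bigr => t tv.
    rewrite /w'; case: ifPn => [/eqP ->|_]; first by rewrite w0 // scale0r add0r.
    by rewrite !inE eq_sym (negPf uv) eq_sym (negPf tv) addr0.
  move/eqP; rewrite addrC addr_eq0 => /eqP ->.
  rewrite (eq_bigl _ _ (fun t => congr1 (andb _) (pairab t))).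
  have [ua|ua] := eqVneq u a.
    rewrite ua (big_pred1 b) => [|t]; last first.
      rewrite (negPf ab) orbF /=.
      by case: (t =P b) => [->|_]; rewrite ?andbF // eq_sym vb.
    by rewrite (setUC [set a]) /s; apply/rowP => i; rewrite !mxE; field.
  have [ub|ub] := eqVneq u b.
    rewrite ub (big_pred1 a) => [|t]; last first.
      rewrite /=.
      by case: (t =P a) => [->|_]; rewrite ?andbF // eq_sym va.
    by rewrite (setUC [set b]) -wab /s; apply/rowP => i; rewrite !mxE; field.
  rewrite big_pred0 => [|t]; last by rewrite andbF.
  rewrite addr0 setUC [w _](_ : _ = 0) ?scale0r ?oppr0 //.
  have [uN|uN] := boolP (u \in nbrs F v); last first.
    by rewrite w0 //; rewrite inE in uN.
  by move: uN; rewrite N !inE (negPf ua) (negPf ub) => /eqP ->.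
have w'00 := ind w' w'0 sw'.
have wa0 : w [set v; a] = 0.
  have := w'00 [set a; b]; rewrite /w' eqxx => /eqP.
  by rewrite mulf_eq0 invr_eq0 pnatr_eq0 => /eqP.
move=> e; have [eF|/w0 //] := boolP (e \in F).
have [ve|ve] := boolP (v \in e); last first.
  have := w'00 e; rewrite /w' (negPf ve); case: eqP => // E _.
  by rewrite -E eF in abF.
have : e \in star F v by rewrite inE eF.
rewrite star_nbrs // N => /imsetP[u uN ->].
by move: uN; rewrite !inE => /orP[/orP[]|] /eqP ->; rewrite // -wab.
Qed.

(** The sufficiency part of Laman's theorem. *)
Theorem sparse_independent p F : generic p -> pairs F -> sparse F ->
  independent p F.
Proof.
move=> gp; have [n] := ubnP #|F|; elim: n F => // n IH F ltn Fp Fs.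
have [->|F0] := eqVneq F set0.
  by move=> w w0 _ e; rewrite w0 ?inE.
have [v] := low_degree Fp Fs F0; rewrite card_star // => /andP[d0 d3].
have ltF : (#|without F v| + #|nbrs F v| = #|F|)%N.
  rewrite -card_star // addnC -cardsUI [_ :&: _](_ : _ = set0) ?cards0 ?addn0.
    by congr #|pred_of_set _|; apply/setP => e; rewrite !inE -andb_orr orbN andbT.
  by apply/setP => e; rewrite !inE; case: (v \in e); rewrite !andbF.
have subF := without_sub F v.
have [le2|gt2] := leqP #|nbrs F v| 2.
  apply: (independent_vertex (v := v) Fp); last first.
    by apply: IH; [lia | exact: pairsS Fp | exact: sparseS Fs].
  have vN u : u \in nbrs F v -> v != u by rewrite inE => /(pairs_neq Fp).
  move=> w w0 sw; have := stress_at v w0 sw.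
  have [/cards1P[a N]|d1] := boolP (#|nbrs F v| == 1)%N.
    rewrite N big_set1 => /eqP; rewrite scaler_eq0 subr_eq0 => /orP[/eqP va|].
      by move=> u; rewrite inE => /eqP ->.
    move/eqP/(generic_inj gp) => va.
    by have := vN a; rewrite N set11 va eqxx => /(_ isT).
  have /cards2P[a [b [ab N]]] : (#|nbrs F v| == 2)%N by lia.
  rewrite N big_setU1 ?inE // big_set1 => eq0.
  have va : v != a by rewrite vN // N set21.
  have vb : v != b by rewrite vN // N set22.
  have := generic_not_collinear gp va ab vb.
  case/(@cross_free (- w [set v; a]) (- w [set v; b])) => [|/eqP + /eqP].
    by rewrite -[RHS]eq0 !scaleNr -!scalerN !opprB.
  rewrite !oppr_eq0 => /eqP wa /eqP wb u.
  by rewrite !inE => /orP[] /eqP ->.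
have /(reducible_pair Fp Fs) [a [b [c [uabc N abF0 s0]]]] : #|nbrs F v| = 3%N.
  by lia.
have p0 : pairs ([set a; b] |: without F v).
  apply/pairsP => e; rewrite in_setU1 => /orP[/eqP ->|/(subsetP subF)].
    by move: uabc; rewrite /= !inE negb_or cards2 => /andP[/andP[-> _] _].
  exact/pairsP.
have abc : cross (p b - p a) (p c - p a) != 0.
  move: uabc; rewrite /= !inE negb_or => /and3P[/andP[ab ac] bc _].
  exact: generic_not_collinear.
have [|q] := independent_edge_split Fp uabc N abF0 abc.
  by apply: IH => //; rewrite cardsU1 abF0; lia.
exact: generic_independent.
Qed.

End Generic.

(** * The rank bound *)

Lemma rank_ge_independent (R : realType) (V : finType) (G : simple_graph V)
    (p : V -> 'rV[R]_2) (F : {set {set V}}) :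
  F \subset edges G -> independent p F -> (#|F| <= rigidity_rank G p)%N.
Proof.
move=> FE ind; have Fp := pairsS FE (pairs_edges G).
have /(introT (independentP p Fp))/eqP <- := ind.
apply: mxrankS; apply/row_subP => i.
have iE : enum_val i \in edges G by apply: (subsetP FE); exact: enum_valP.
rewrite (_ : row i _ = row (enum_rank_in iE (enum_val i)) (rigidity_matrix G p)).
  exact: row_sub.
by apply/rowP => j; rewrite !mxE enum_rankK_in.
Qed.

Theorem theorem1p3 (R : realType) (V : finType) (G : simple_graph V)
    (Gconn : graph_connected G) (Gval : regular 4 G)
    (Gec : edge_connected 4 G)
    (p : V -> 'rV[R]_2) (pgen : generic p) :
  (7 * #|V|%:R - 7) / 4 <= (rigidity_rank G p)%:R :> rat.
Proof.
have [F [FE Fs maxF]] := maximal_sparse (edges G).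
have Ep := pairs_edges G.
have reg v : #|nbrs (edges G) v| = 4%N by rewrite nbrs_edges Gval.
have size :=
  sparse_size Ep FE Fs maxF reg (fun X => edge_connected_boundary Gec).
have rk : (#|F| <= rigidity_rank G p)%N.
  apply: rank_ge_independent => //; apply: sparse_independent => //.
  exact: pairsS Ep.
have bound : (7 * #|V| <= 4 * rigidity_rank G p + 7)%N.
  case: size => [|size]; first by lia.
  (* A vertex and its four neighbours give [|V| >= 5], whence
     [2|V| - 3 >= (7|V| - 7) / 4]. *)
  have [V0|/card_gt0P[v _]] := posnP #|V|; first by rewrite V0.
  have : (#|nbrs (edges G) v| <= #|[set~ v]|)%N.
    apply: subset_leq_card; apply/subsetP => u; rewrite !inE.
    by move/(pairs_neq Ep); rewrite eq_sym.
  by rewrite reg cardsC1; lia.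
rewrite ler_pdivrMr // lerBlDr mulrC -!natrM -natrD ler_nat; lia.
Qed.
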